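(* Let $n\geq 3$ be an integer. The shortest $2$-reachability network on $n$ elements in which each transposition is a star transposition contains exactly $\lceil 3(n-1)/2\rceil$ transpositions; that is, there exists a $2$-reachability network on $n$ elements of length $\lceil 3(n-1)/2\rceil$ consisting only of star transpositions, and every $2$-reachability network on $n$ elements consisting only of star transpositions has length at least $\lceil 3(n-1)/2\rceil$.
   Context: Write $[n]=\{1,\dots,n\}$, let $S_n$ be the symmetric group on $[n]$, and for distinct $a,b\in[n]$ let $(a,b)\in S_n$ denote the transposition swapping $a$ and $b$. A star transposition is a transposition of the form $(1,x)$ with $x\in\{2,\dots,n\}$. For $1\le t\le n$, a finite sequence of transpositions $T_1,\dots,T_\ell\in S_n$ (repetitions allowed), with $T_i=(a_i,b_i)$, is a $t$-reachability network on $n$ elements if for every choice of $t$ distinct ordered points $x_1,\dots,x_t\in[n]$ there is a (possibly empty) subsequence $T_{i_1},\dots,T_{i_{\ell'}}$ with $i_1<\dots<i_{\ell'}$ whose composition $(a_{i_1},b_{i_1})\cdots(a_{i_{\ell'}},b_{i_{\ell'}})$ maps $j\mapsto x_j$ for every $1\le j\le t$. Products are applied in the order of the sequence, left to right: $T_{i_1}$ is applied first (equivalently, counters placed at positions $1,\dots,t$ are moved by carrying out the chosen switches in order, and counter $j$ must end at position $x_j$). The length of the network is $\ell$, the number of transpositions in the sequence. *)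

(* Defs.v *)
From mathcomp Require Import all_boot all_fingroup.

Set Implicit Arguments.
Unset Strict Implicit.
Unset Printing Implicit Defensive.

(* The point p of [n] = {1, ..., n} is represented by the
   element of 'I_n with value p - 1. *)

Definition is_transposition n (s : {perm 'I_n}) : Prop :=
  exists a b : 'I_n, a != b /\ s = tperm a b.

Definition is_star_transposition n (s : {perm 'I_n}) : Prop :=
  exists a x : 'I_n, [/\ a = 0 :> nat, x != a & s = tperm a x].

(* The product of permutations in MathComp is in diagrammatic order,
   (s * t) i = t (s i), so the first permutation of S is applied first.
   The equation i = j :> nat identifies the counter j : 'I_t with its starting
   position i : 'I_n. *)
Definition reachability_network n (t : nat) (T : seq {perm 'I_n}) : Prop :=
  [/\ 0 < t <= n,
      forall s, s \in T -> is_transposition s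
    & forall x : 'I_t -> 'I_n, injective x ->
        exists2 S : seq {perm 'I_n}, subseq S T &
          forall (j : 'I_t) (i : 'I_n), i = j :> nat ->
            (\prod_(s <- S) s)%g i = x j].

Definition star_network n (T : seq {perm 'I_n}) : Prop :=
  forall s, s \in T -> is_star_transposition s.

(* Main.v *)
Require Import Defs.
From mathcomp Require Import all_boot all_fingroup.
From mathcomp Require Import zify.

Set Implicit Arguments.
Unset Strict Implicit.
Unset Printing Implicit Defensive.

(** A star network is a word in the letters x <> 1, and position 1 is the hub.
    Lower bound. If x occurs once, then after x and before the next letter
    occurring once (or the end of the word) some letter p seen before x must
    occur again. So, among the m = n - 1 letters, if k occur
    once then the length is at least m + k; it is also at least
    k + 2 (m - k), and adding the two bounds gives 3 m / 2.
    Upper bound. Writing 0 for the hub and 1, ..., n - 1 for the other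
    positions, use the word consisting of 1, 2, the odd letters >= 3, 1, and
    finally n - 1, ..., 4, 3. *)

(** * Counting distinct, repeated and single letters of a sequence *)

Section SeqLemmas.

Variable I : eqType.
Implicit Types s A B : seq I.

Lemma subseq_cat_split s A B : subseq s (A ++ B) ->
  exists s1 s2, [/\ s = s1 ++ s2, subseq s1 A & subseq s2 B].
Proof.
case/subseqP=> m sz_m ->; rewrite -(cat_take_drop (size A) m) mask_cat.
  exists (mask (take (size A) m) A), (mask (drop (size A) m) B).
  by rewrite !mask_subseq.
by rewrite size_takel // sz_m size_cat leq_addr.
Qed.

Lemma subseq_cons_split s x A : subseq s (x :: A) ->
  subseq s A \/ exists2 s', s = x :: s' & subseq s' A.
Proof.
case: s => [|y s] /=; first by left; apply: sub0seq.
by case: eqP => [-> ?|_ ?]; [right; exists s | left].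
Qed.

Lemma size_undup_rcons s x : size (undup (rcons s x)) = (x \notin s) + size (undup s).
Proof.
have /perm_size : perm_eq (undup (rcons s x)) (undup (x :: s)).
  by apply: perm_undup => y; rewrite mem_rcons.
by move=> -> /=; case: (x \in s).
Qed.

(** Each marked letter pays for a repeat in the stretch up to the next marked letter; these
    stretches are disjoint, and a repeat adds nothing to [undup s]. *)
Lemma undup_marked_size (P : pred I) s :
  (forall A x B, s = A ++ x :: B -> P x -> has (mem A) (take (find P B) B)) ->
  size (undup s) + count P s <= size s.
Proof.
move=> reuse.
(* [A] is the part already read; the third summand is 1 when a repeat of a letter of [A] is still to
   come before the next marked letter of [B]. *)
suff gen B A : s = A ++ B ->
    size (undup s) + count P B + has (mem A) (take (find P B) B)
      <= size (undup A) + size B.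
  by have := gen s [::] erefl; rewrite /= add0n; lia.
elim: B A => [|c B IH] A def_s.
  by rewrite def_s cats0 /=; lia.
have := IH (rcons A c); rewrite cat_rcons => /(_ def_s).
have sub : has (mem A) (take (find P B) B) -> has (mem (rcons A c)) (take (find P B) B).
  by apply: sub_has => y /= Ay; rewrite mem_rcons inE Ay orbT.
rewrite size_undup_rcons /=.
case: ifP => Pc /=.
  by rewrite (sub (reuse _ _ _ def_s Pc)); case: (c \in A) => /=; lia.
case: (c \in A) => /=; first by lia.
by case: (has (mem A) _) sub => [->|_] //=; lia.
Qed.

(** A letter of multiplicity k contributes k to the size, and 1 more if k = 1: at least 2 in all. *)
Lemma size_undup_once s :
  2 * size (undup s) <= size s + count (fun x => count_mem x s == 1) s.
Proof.
have sum_undup (F : I -> nat) :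
    \sum_(x <- undup s) count_mem x s * F x = \sum_(x <- s) F x.
  rewrite -[RHS]big_undup_iterop_count; apply: eq_bigr => x _.
  by rewrite mulnC Monoid.iteropE iter_addn_0.
rewrite -[size s]sum1_size -sum1_count [X in _ + X]big_mkcond.
rewrite -(sum_undup (fun=> 1)) -sum_undup.
rewrite -big_split mulnC -[size (undup s)]sum1_size big_distrl /=.
rewrite [X in X <= _]big_seq [X in _ <= X]big_seq.
apply: leq_sum => x; rewrite mem_undup -has_pred1 has_count.
by case: eqP; lia.
Qed.

End SeqLemmas.

(** * Words as products of star transpositions *)

Section StarWords.

Variable m : nat.
Implicit Types (v w : seq 'I_m.+1) (p x y : 'I_m.+1).

Definition star_prod v : {perm 'I_m.+1} := (\prod_(x <- v) tperm ord0 x)%g.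

Lemma star_prod_nil p : star_prod [::] p = p.
Proof. by rewrite /star_prod big_nil perm1. Qed.

Lemma star_prod_cons x v p : star_prod (x :: v) p = star_prod v (tperm ord0 x p).
Proof. by rewrite /star_prod big_cons permM. Qed.

Lemma star_prod_cat v1 v2 p : star_prod (v1 ++ v2) p = star_prod v2 (star_prod v1 p).
Proof. by rewrite /star_prod big_cat permM. Qed.

Lemma star_prod_id v p : p != ord0 -> p \notin v -> star_prod v p = p.
Proof.
move=> p0; elim: v => [|x v IH]; first by rewrite star_prod_nil.
rewrite inE negb_or star_prod_cons => /andP[px pv].
by rewrite tpermD ?IH // eq_sym.
Qed.

Lemma star_prod_mem v p : star_prod v p \in [:: p, ord0 & v].
Proof.
elim: v p => [|x v IH] p; first by rewrite star_prod_nil mem_head.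
rewrite star_prod_cons; have := IH (tperm ord0 x p).
by rewrite !inE; case: tpermP => [->|->|_ _] /or3P[] ->; rewrite ?orbT.
Qed.

Definition reaches2 w (i j : 'I_m.+1) := forall a b, a != b ->
  exists2 v, subseq v w & star_prod v i = a /\ star_prod v j = b.

End StarWords.

(** * Lower bound *)

Section LowerBound.

Variable m : nat.
Variables (j : 'I_m.+3) (w : seq 'I_m.+3).
Hypotheses (w0 : ord0 \notin w) (reach_w : reaches2 w ord0 j).

Lemma exists_third (a b : 'I_m.+3) : exists c, (c != a) && (c != b).
Proof.
have /subsetPn[c _] : ~~ ([set: 'I_m.+3] \subset [set a; b]).
  apply: contraL (leqnn m.+3) => /subset_leq_card.
  by rewrite cardsT card_ord cards2; case: (a != b) => /=; lia.
by rewrite !inE negb_or; exists c.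
Qed.

Lemma reaches2_mem x : x != ord0 -> x \in w.
Proof.
move=> x0; have [b /andP[bx _]] := exists_third x x.
have [] := reach_w (a := x) (b := b); first by rewrite eq_sym.
move=> v /mem_subseq sub_v [vx _]; apply: sub_v.
by have := star_prod_mem v ord0; rewrite vx !inE (negPf x0).
Qed.

(* Send counter j to x (or anywhere else than j, if x = j), and send counter 0 to
   y if B starts with y, to the hub if B is empty. Then x must be used, with
   counter 0 parked at some p in A, and p must recur in M for counter 0 to come
   back in time. *)
Lemma reaches2_reuse A x M B :
    w = A ++ x :: M ++ B -> x \notin A -> x \notin M ++ B ->
    (if B is y :: B' then (y \notin A) && (y \notin B') else true) ->
  has (mem A) M.
Proof.
move=> def_w xA xMB By; apply/negPn/negP => noM.
have x0 : x != ord0 by apply: contraNneq w0 => <-; rewrite def_w mem_cat mem_head orbT.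
have [a [ax aA def_a]] : exists a, [/\ a != x, a \notin A & a = head ord0 B].
  exists (head ord0 B); split=> //.
    case: B xMB {By def_w} => [|y B] /=; first by rewrite eq_sym.
    by rewrite mem_cat !inE eq_sym !negb_or => /and3P[].
  case: B By def_w {xMB} => [_|y B /andP[]//] /= def_w.
  by apply: contra w0; rewrite def_w mem_cat => ->.
(* The choice of [b] makes it impossible for counter [j] to end at [b] while [x] is fixed, so [x]
   has to be used. *)
have [b ab bx] : exists2 b, a != b & forall s : {perm 'I_m.+3}, s j = b -> s x = x -> False.
  have [xj | xj] := eqVneq x j.
    have [b /andP[ba bj]] := exists_third a j.
    exists b; first by rewrite eq_sym.
    by move=> s sb; rewrite xj sb => /eqP; rewrite (negPf bj).
  by exists x => // s sj sx; case/eqP: xj; apply: (@perm_inj _ s); rewrite sj.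
have [v + [va vb]] := reach_w ab.
rewrite def_w => /subseq_cat_split[v1 [v2 [def_v /mem_subseq s1 +]]].
have xv1 : x \notin v1 by apply: contra xA; apply: s1.
case/subseq_cons_split => [/mem_subseq s2 | [v3 def_v2 s3]].
  apply: (bx _ vb); apply: star_prod_id => //.
  by rewrite def_v mem_cat negb_or xv1; apply: contra xMB; apply: s2.
have xv3 : x \notin v3 by apply: contra xMB; apply: (mem_subseq s3).
move: va; rewrite def_v def_v2 star_prod_cat star_prod_cons.
(* [p] is where counter 0 sits just before [x] is used. From the hub it would go to [x] and stay
   there, although [a] is not [x]; so it is parked at a letter of [A]. *)
have := star_prod_mem v1 ord0; set p := star_prod v1 ord0.
have [-> _ | p0] := eqVneq p ord0.
  by rewrite tpermL star_prod_id // => xa; rewrite xa eqxx in ax.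
rewrite !inE (negPf p0) => /s1 pA.
have xp : x != p by apply: contraNneq xA => ->.
rewrite tpermD //; last by rewrite eq_sym.
(* By [noM], the letters chosen from [M] leave counter 0 at [p]. *)
have [v4 [v5 [-> /mem_subseq s4 s5]]] := subseq_cat_split s3.
rewrite star_prod_cat (@star_prod_id _ v4) //; last first.
  by apply: contra noM => pv4; apply/hasP; exists p => //; apply: s4.
have pa : p != a by apply: contraNneq aA => <-.
case: B def_w {xMB s3} By def_a s5 => [|y B] def_w By def_a.
  rewrite subseq0 => /eqP->; rewrite star_prod_nil => pa_eq.
  by rewrite pa_eq eqxx in pa.
move: pa aA; rewrite def_a /= => pa yA s5.
have [_ yB] := andP By.
have y0 : y != ord0.
  by apply: contraNneq w0 => <-; rewrite def_w !(mem_cat, inE) eqxx !orbT.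
(* [B] is now the tail after [y]. Its letters fix [y], hence send no other point there; and using
   [y] itself does not move [p]. *)
have stay v6 : subseq v6 B -> star_prod v6 p = y -> False.
  move=> /mem_subseq s6 ha; case/eqP: pa; apply: (@perm_inj _ (star_prod v6)).
  by rewrite ha star_prod_id //; apply: contra yB; apply: s6.
case/subseq_cons_split: s5 => [|[v6 ->]]; first exact: stay.
by rewrite star_prod_cons tpermD 1?eq_sym //; apply: stay.
Qed.

Lemma reaches2_size : 3 * m.+2 <= 2 * size w.
Proof.
have le_undup : m.+2 <= size (undup w).
  suff: size [seq lift ord0 i | i <- enum 'I_m.+2] <= size (undup w).
    by rewrite size_map size_enum_ord.
  apply: uniq_leq_size => [|x /mapP[i _ ->]].
    by rewrite map_inj_uniq ?enum_uniq //; apply: lift_inj.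
  by rewrite mem_undup reaches2_mem // eq_sym neq_lift.
pose once x := count_mem x w == 1.
have : size (undup w) + count once w <= size w.
  apply: undup_marked_size => A x B def_w.
  have once_split A' y B' : w = A' ++ y :: B' -> once y -> (y \notin A') && (y \notin B').
    move=> def; rewrite /once def count_cat /= eqxx -!has_pred1 !has_count.
    by rewrite add1n addnS eqSS addn_eq0 => /andP[/eqP-> /eqP->].
  move=> /(once_split _ _ _ def_w)/andP[xA xB].
  (* Cut [B] before its next letter occurring once; that letter, if any, is the [y] of
     [reaches2_reuse]. *)
  apply: (@reaches2_reuse _ x _ (drop (find once B) B)); rewrite ?cat_take_drop //.
  case def_B: (drop _ _) => [|y B'] //.
  have lt_find : find once B < size B.
    by rewrite ltnNge; apply/negP => /drop_oversize; rewrite def_B.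
  have once_y : once y.
    have := @nth_find _ ord0 once B; rewrite has_find => /(_ lt_find).
    by rewrite -[find _ _]addn0 -nth_drop def_B.
  have := once_split (A ++ x :: take (find once B) B) y B'.
  rewrite -catA /= -def_B cat_take_drop => /(_ def_w once_y).
  by rewrite mem_cat negb_or => /andP[/andP[-> _]].
(* With d distinct letters and k occurring once, d + k and 2 d - k are both at most [size w]; adding
   cancels k. *)
have : 2 * size (undup w) <= size w + count once w := size_undup_once w.
move: le_undup; move: (size (undup w)) (count once w) (size w); lia.
Qed.

End LowerBound.

(** * Upper bound: explicit routes, computed on natural numbers *)

Definition star_swap (p k : nat) : nat :=
  if p == k then 0 else if p == 0 then k else p.

Lemma star_prod_inord m (v : seq nat) (p : 'I_m.+3) : all (gtn m.+3) v ->
  star_prod [seq inord k | k <- v] p = foldl star_swap p v :> nat.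
Proof.
elim: v p => [|k v IH] p /=; first by rewrite star_prod_nil.
case/andP=> lt_k lt_v; rewrite star_prod_cons IH //; congr foldl.
rewrite /star_swap; case: tpermP => [->|->|/eqP p0 /eqP pk].
- by rewrite inordK // [ord0 == 0 :> nat]eqxx; case: eqP.
- by rewrite inordK // eqxx.
- move: p0 pk; rewrite -!val_eqE /= inordK // => p0 pk.
  by rewrite (negPf p0) (negPf pk).
Qed.

(** Splitting on innermost comparisons first resolves nested swaps in their order of application;
    contradictory branches go to [lia]. *)
Ltac eval_star_swap :=
  repeat match goal with
  | |- context [if ?p == ?k then _ else _] =>
      lazymatch p with context [if _ then _ else _] => fail | _ => idtac end;
      case: (@eqP _ p k) => ?; try (exfalso; lia)
  end; lia.

Ltac solve_route :=
  split; [split=> //=; lia | rewrite /star_swap /=; split; eval_star_swap].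

Section UpperBound.

Variable q : nat.

(* The even letters k >= 4 occur once, in descending order at the end, each
   followed by a second occurrence of k - 1, where a counter can be parked
   while k is used. *)
Definition star_word : seq nat :=
  [:: 1; 2] ++ [seq i.*2 + 3 | i <- iota 0 (uphalf q)] ++ [:: 1] ++ rev (iota 3 q).

(** The last move of a route: a counter waiting at the hub goes to [y], or stays if [y] is the
    hub. *)
Definition hop y : seq nat := if y == 0 then [::] else [:: y].

Lemma size_star_word : size star_word = uphalf (3 * (q + 2)).
Proof. by rewrite /star_word !size_cat size_map size_rev !size_iota /=; lia. Qed.

Lemma star_word_bound : all (fun k => 0 < k < q.+3) star_word.
Proof.
apply/allP => k; rewrite !(mem_cat, inE) mem_rev mem_iota.
case/or4P=> [|/mapP[i]|/eqP->|] //; last by lia.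
  by case/orP=> /eqP->; lia.
by rewrite mem_iota => ? ->; lia.
Qed.

(** Filtering [iota 3 q] by membership in [s] gives a strictly increasing list with the same members
    as [rev s], hence [rev s] itself. *)
Lemma subseq_rev_iota s :
  sorted gtn s -> all (fun k => 3 <= k < q.+3) s -> subseq s (rev (iota 3 q)).
Proof.
move=> sorted_s /allP s_in; rewrite -(revK s) subseq_rev.
rewrite -(@irr_sorted_eq _ ltn ltn_trans ltnn [seq k <- iota 3 q | k \in rev s] (rev s)).
- exact: filter_subseq.
- by apply: sorted_filter; [apply: ltn_trans | apply: iota_ltn_sorted].
- by rewrite rev_sorted.
- move=> k; rewrite mem_filter mem_rev mem_iota.
  by case: (boolP (k \in s)) => //= /s_in; lia.
Qed.

(** A route takes one piece from each of the four blocks; one letter of the odd block is enough for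
    every route below. *)
Lemma subseq_star_word s1 s2 s3 s4 :
    subseq s1 [:: 1; 2] -> all (fun k => odd k && (3 <= k < q.+3)) s2 -> size s2 <= 1 ->
    subseq s3 [:: 1] -> sorted gtn s4 -> all (fun k => 3 <= k < q.+3) s4 ->
  subseq (s1 ++ s2 ++ s3 ++ s4) star_word.
Proof.
move=> sub1 odd2 sz2 sub3 sorted4 bound4.
rewrite /star_word; do 2?[apply: cat_subseq => //]; last first.
  by apply: cat_subseq => //; apply: subseq_rev_iota.
case: s2 odd2 sz2 => [|k []] //=; first by rewrite sub0seq.
case/andP=> /andP[odd_k bound_k] _ _; rewrite sub1seq; apply/mapP.
by exists (k - 3)./2; rewrite ?mem_iota; lia.
Qed.

Lemma star_word_reaches a b : a < q.+3 -> b < q.+3 -> a != b ->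
  exists2 v, subseq v star_word & foldl star_swap 0 v = a /\ foldl star_swap 1 v = b.
Proof.
pose good s1 s2 s3 s4 := [/\ subseq s1 [:: 1; 2],
  all (fun k => odd k && (3 <= k < q.+3)) s2 && (size s2 <= 1), subseq s3 [:: 1]
  & sorted gtn s4 && all (fun k => 3 <= k < q.+3) s4].
move=> lt_a lt_b ab.
suff [s1 [s2 [s3 [s4 [[sub1 /andP[? ?] sub3 /andP[? ?]] run]]]]] :
    exists s1 s2 s3 s4, good s1 s2 s3 s4 /\
      (foldl star_swap 0 (s1 ++ s2 ++ s3 ++ s4) = a /\
       foldl star_swap 1 (s1 ++ s2 ++ s3 ++ s4) = b).
  by exists (s1 ++ s2 ++ s3 ++ s4) => //; apply: subseq_star_word.
have end_hop y : y < q.+3 -> (y != 1) && (y != 2) ->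
    hop y = [::] /\ y = 0 \/ hop y = [:: y] /\ 3 <= y < q.+3.
  by rewrite /hop; case: (@eqP _ y 0) => ? ? ?; [left | right]; split=> //; lia.
(* If a target is 1 or 2, the letters 1, 2 and the second 1 settle it, and one hop at most
   remains. *)
have [b1 | b1] := eqVneq b 1.
  have [a2 | a2] := eqVneq a 2.
    by exists [:: 2], [::], [::], [::]; subst; solve_route.
  exists [::], [::], [::], (hop a).
  by case: (end_hop a lt_a) => [|[-> ?]|[-> ?]]; first (by lia); subst; solve_route.
have [a1 | a1] := eqVneq a 1.
  have [b2 | b2] := eqVneq b 2.
    by exists [:: 1; 2], [::], [::], [::]; subst; solve_route.
  exists [:: 1], [::], [::], (hop b).
  by case: (end_hop b lt_b) => [|[-> ?]|[-> ?]]; first (by lia); subst; solve_route.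
have [a2 | a2] := eqVneq a 2.
  exists [:: 2], [::], [:: 1], (hop b).
  by case: (end_hop b lt_b) => [|[-> ?]|[-> ?]]; first (by lia); subst; solve_route.
have [b2 | b2] := eqVneq b 2.
  exists [:: 1; 2], [::], [:: 1], (hop a).
  by case: (end_hop a lt_a) => [|[-> ?]|[-> ?]]; first (by lia); subst; solve_route.
(* Neither target is 1 or 2 now. An odd target is filled in the odd block; the next 1 then brings
   the other counter to the hub for its hop. *)
have [odd_a | even_a] := boolP (odd a).
  exists [::], [:: a], [:: 1], (hop b).
  by case: (end_hop b lt_b) => [|[-> ?]|[-> ?]]; first (by lia); subst; solve_route.
have [odd_b | even_b] := boolP (odd b).
  exists [:: 1], [:: b], [:: 1], (hop a).
  by case: (end_hop a lt_a) => [|[-> ?]|[-> ?]]; first (by lia); subst; solve_route.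
(* Both targets are even; let c be the larger. The counter with the smaller target parks at c - 1,
   the other comes through 1 to the hub and goes to c, then c - 1 releases the parked one, whose
   target is below c - 1. *)
have [lt_ab | le_ba] := ltnP a b.
  exists [::], [:: b.-1], [:: 1], ([:: b; b.-1] ++ hop a).
  by case: (end_hop a lt_a) => [|[-> ?]|[-> ?]]; first (by lia); subst; solve_route.
exists [:: 1], [:: a.-1], [:: 1], ([:: a; a.-1] ++ hop b).
by case: (end_hop b lt_b) => [|[-> ?]|[-> ?]]; first (by lia); subst; solve_route.
Qed.

End UpperBound.

(* uphalf k = k.+1./2 is the ceiling of k / 2 *)
Theorem theorem4 (n : nat) (hn : 3 <= n) :
  (exists T : seq {perm 'I_n},
     [/\ reachability_network 2 T, star_network T
       & size T = uphalf (3 * (n - 1))]) /\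
  (forall T : seq {perm 'I_n},
     reachability_network 2 T -> star_network T ->
     uphalf (3 * (n - 1)) <= size T).
Proof.
case: n hn => [|[|[|m]]] // _; pose one := inord 1 : 'I_m.+3.
have val_one : one = 1 :> nat by rewrite inordK.
split; last first.
  move=> T [_ _ reach_T] star_T.
  (* The letter of a star transposition is its image of the hub. *)
  have def_T : T = [seq tperm ord0 x | x <- [seq s ord0 | s : {perm 'I_m.+3} <- T]].
    rewrite -map_comp -[LHS]map_id; apply/eq_in_map => s /star_T [a [x [a0 _ ->]]].
    have -> : a = ord0 by apply: val_inj.
    by rewrite /= tpermL.
  set w := [seq s ord0 | s : {perm 'I_m.+3} <- T] in def_T.
  have w0 : ord0 \notin w.
    apply/mapP => -[s /star_T [a [x [a0 xa ->]]]].
    have def_a : a = ord0 by apply: val_inj.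
    by rewrite def_a tpermL => x0; rewrite def_a x0 eqxx in xa.
  have := @reaches2_size m one w w0; rewrite /w size_map.
  suff reach_w : reaches2 w ord0 one by move=> /(_ reach_w); lia.
  move=> a b ab; pose x (i : 'I_2) := if i == 0 :> nat then a else b.
  have inj_x : injective x.
    move=> [[|[|i]] lt_i] [[|[|k]] lt_k] //=; rewrite /x /= => xx; apply: val_inj => //=.
      by rewrite xx eqxx in ab.
    by rewrite xx eqxx in ab.
  have [S + run] := reach_T x inj_x.
  (* The mask extracting [S] from [T] extracts the corresponding word from [w]. *)
  rewrite {1}def_T => /subseqP[k _ def_S]; exists (mask k w); first exact: mask_subseq.
  rewrite /star_prod -(big_map (tperm ord0) xpredT id) map_mask -def_S.
  by split; [rewrite (run ord0) | rewrite (run (Ordinal (isT : 1 < 2)))].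
pose T : seq {perm 'I_m.+3} := [seq tperm ord0 (inord k) | k <- star_word m].
have star_T s : s \in T -> exists2 x : 'I_m.+3, x != ord0 & s = tperm ord0 x.
  case/mapP=> k /(allP (star_word_bound m)) k_bound ->; exists (inord k) => //.
  by rewrite -val_eqE /= inordK; lia.
exists T; split; last by rewrite size_map size_star_word; congr uphalf; lia.
  split=> // [s /star_T[x x0 ->] | x inj_x].
    by exists ord0, x; rewrite eq_sym.
  (* In ['I_2], [ord_max] is the second counter. *)
  have [|||v sub_v [run0 run1]] := @star_word_reaches m (x ord0) (x ord_max).
  - exact: ltn_ord.
  - exact: ltn_ord.
  - by rewrite val_eqE; apply/eqP => /inj_x.
  exists [seq tperm ord0 (inord k) | k <- v]; first exact: map_subseq.
  have bound_v : all (gtn m.+3) v.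
    by apply/allP => k /(mem_subseq sub_v)/(allP (star_word_bound m))/andP[].
  have eval (p : 'I_m.+3) : (\prod_(s <- [seq tperm ord0 (inord k) | k <- v]) s)%g p
      = foldl star_swap p v :> nat.
    by rewrite -star_prod_inord // /star_prod !big_map.
  move=> j i ij; apply: val_inj; rewrite /= eval ij.
  case: j ij => [[|[|j]] lt_j] //= _; [rewrite run0 | rewrite run1];
    by congr (nat_of_ord (x _)); apply: val_inj.
by move=> s /star_T[x x0 ->]; exists ord0, x.
Qed.
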